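(* Let $s$ be a faithful state over an injective involutive bisemilattice $\mathbf B$, topologised by $d_s$, with Booleanisation $\mathbf A_\infty$ topologised by $d_\infty$ and projection $\pi\colon B\to A_\infty$. Let $t\colon B\to[0,1]$ be a continuous map such that $t\circ\sigma=\Phi(s)$ for every section $\sigma\colon A_\infty\to B$ of $\pi$. Then $t=s$.
   Context: An involutive bisemilattice is an algebra $\mathbf B=\langle B,\wedge,\vee,',0,1\rangle$ of type $(2,2,1,0,0)$ satisfying $x\vee x\approx x$, $x\vee y\approx y\vee x$, $x\vee(y\vee z)\approx(x\vee y)\vee z$, $(x')'\approx x$, $x\wedge y\approx(x'\vee y')'$, $x\wedge(x'\vee y)\approx x\wedge y$, $0\vee x\approx x$, $1\approx 0'$. Every involutive bisemilattice is (canonically) the Płonka sum of a semilattice direct system of Boolean algebras, and $\mathbf B$ is identified with it: a join-semilattice $(I,\vee)$ with least element $i_0$, Boolean algebras $\mathbf A_i$ with pairwise disjoint universes, Boolean homomorphisms $p_{ij}\colon\mathbf A_i\to\mathbf A_j$ ($i\le j$) with $p_{ii}=\mathrm{id}$, $p_{ik}=p_{jk}\circ p_{ij}$; $B=\bigsqcup_iA_i$; for $a\in A_i$, $b\in A_j$, $k=i\vee j$: $a\wedge b=p_{ik}(a)\wedge^{\mathbf A_k}p_{jk}(b)$, $a\vee b=p_{ik}(a)\vee^{\mathbf A_k}p_{jk}(b)$; $a'$ computed in the algebra containing $a$; $0,1$ those of $\mathbf A_{i_0}$. $0_i$ is the bottom of $\mathbf A_i$. $\mathbf B$ is injective if every $p_{ij}$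 is injective. A state is a map $s\colon B\to[0,1]$ with $s(1)=1$ and $s(a\vee b)=s(a)+s(b)$ whenever $a\wedge b\in\{0_i:i\in I\}$; faithful if $s(a)>0$ for all $a\in B\setminus\{0_i:i\in I\}$. Booleanisation: $a\sim b$ (for $a\in A_i,b\in A_j$) iff $p_{ik}(a)=p_{jk}(b)$ for some $k\ge i,j$; $\mathbf A_\infty=B/{\sim}$, $\pi(a)=[a]_\sim$. $\Phi(s)$ is the finitely additive probability measure on $\mathbf A_\infty$ with $\Phi(s)([b]_\sim)=s(b)$. With $x\triangle y=(x\wedge y')\vee(x'\wedge y)$: $d_s(a,b)=s(a\triangle b)$ and $d_\infty(x,y)=\Phi(s)(x\triangle y)$; topologies are those induced by these (pseudo)metrics, and $[0,1]$ has the usual topology. A section of $\pi$ is a continuous map $\sigma\colon A_\infty\to B$ with $\pi\circ\sigma=\mathrm{id}_{A_\infty}$. *)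

(* Defs.v *)
From HB Require Import structures.
From mathcomp Require Import all_boot all_order all_algebra.
From mathcomp Require Import generic_quotient.
From mathcomp Require Import boolp classical_sets reals topology normedtype.

Set Implicit Arguments.
Unset Strict Implicit.
Unset Printing Implicit Defensive.

Import Order.Theory GRing.Theory Num.Theory.
Import numFieldNormedType.Exports.

Local Open Scope order_scope.
Local Open Scope quotient_scope.

Record is_involutive_bisemilattice (B : Type) (meet join : B -> B -> B)
    (neg : B -> B) (zero one : B) : Prop := IsInvolutiveBisemilattice {
  ibsl_joinxx : forall x, join x x = x;
  ibsl_joinC : forall x y, join x y = join y x;
  ibsl_joinA : forall x y z, join x (join y z) = join (join x y) z;
  ibsl_negK : forall x, neg (neg x) = x;
  ibsl_meetE : forall x y, meet x y = neg (join (neg x) (neg y));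
  ibsl_meetNU : forall x y, meet x (join (neg x) y) = meet x y;
  ibsl_join0x : forall x, join zero x = x;
  ibsl_oneE : one = neg zero
}.

(* Spelled out because the library's {tblmorphism _ -> _} only preserves \bot and \top. *)
Record is_boolean_hom (d d' : Order.disp_t) (A : ctbDistrLatticeType d)
    (A' : ctbDistrLatticeType d') (f : A -> A') : Prop := IsBooleanHom {
  bhomI : forall x y, f (x `&` y) = f x `&` f y;
  bhomU : forall x y, f (x `|` y) = f x `|` f y;
  bhomC : forall x, f (~` x) = ~` f x;
  bhom0 : f \bot = \bot;
  bhom1 : f \top = \top
}.

(* The least index, written i_0 in the literature, is \bot. *)
Record boolean_system (d d' : Order.disp_t) (I : bJoinSemilatticeType d) :=
  BooleanSystem {
  fib : I -> ctbDistrLatticeType d';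
  tr : forall i j, i <= j -> fib i -> fib j;
  tr_hom : forall i j (ij : i <= j), is_boolean_hom (tr ij);
  tr_id : forall i (ii : i <= i) x, tr ii x = x;
  tr_comp : forall i j k (ij : i <= j) (jk : j <= k) (ik : i <= k) x,
    tr ik x = tr jk (tr ij x)
}.
Arguments tr {d d' I} D {i j} _ _ : rename.
Arguments tr_hom {d d' I} D {i j} _ : rename.
Arguments tr_id {d d' I} D {i} _ _ : rename.
Arguments tr_comp {d d' I} D {i j k} _ _ _ _ : rename.

Definition injective_system d d' (I : bJoinSemilatticeType d)
    (D : boolean_system d' I) : Prop :=
  forall (i j : I) (ij : i <= j), injective (tr D ij).

Section PlonkaSum.
Context {d d' : Order.disp_t} {I : bJoinSemilatticeType d}.
Variable D : boolean_system d' I.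

Definition plonka : Type := {i : I & fib D i}.
HB.instance Definition _ := Choice.on plonka.

Definition inj (i : I) (a : fib D i) : plonka := Tagged (fib D) a.

Definition pmeet (a b : plonka) : plonka :=
  inj (tr D (leUl (tag a) (tag b)) (tagged a) `&`
       tr D (leUr (tag b) (tag a)) (tagged b)).
Definition pjoin (a b : plonka) : plonka :=
  inj (tr D (leUl (tag a) (tag b)) (tagged a) `|`
       tr D (leUr (tag b) (tag a)) (tagged b)).
Definition pneg (a : plonka) : plonka := inj (~` tagged a).
Definition pzero : plonka := inj (\bot : fib D \bot).
Definition pone : plonka := inj (\top : fib D \bot).

Definition is_fib_bot (a : plonka) : Prop :=
  exists i : I, a = inj (\bot : fib D i).

Definition psymdiff (a b : plonka) : plonka :=
  pjoin (pmeet a (pneg b)) (pmeet (pneg a) b).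

Definition bool_equiv (a b : plonka) : Prop :=
  exists (k : I) (ak : tag a <= k) (bk : tag b <= k),
    tr D ak (tagged a) = tr D bk (tagged b).

Let trI i j (ij : i <= j) := bhomI (tr_hom D ij).
Let trU i j (ij : i <= j) := bhomU (tr_hom D ij).
Let trN i j (ij : i <= j) := bhomC (tr_hom D ij).
Let tr0 i j (ij : i <= j) := bhom0 (tr_hom D ij).
Let tr1 i j (ij : i <= j) := bhom1 (tr_hom D ij).

Lemma pjoin_inj (i j k : I) (ik : i <= k) (jk : j <= k) (a : fib D i)
    (b : fib D j) : k = i `|` j ->
  pjoin (inj a) (inj b) = inj (tr D ik a `|` tr D jk b).
Proof.
by move=> e; subst k; rewrite /pjoin /=
  (bool_irrelevance ik (leUl i j)) (bool_irrelevance jk (leUr j i)).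
Qed.

Lemma pmeet_inj (i j k : I) (ik : i <= k) (jk : j <= k) (a : fib D i)
    (b : fib D j) : k = i `|` j ->
  pmeet (inj a) (inj b) = inj (tr D ik a `&` tr D jk b).
Proof.
by move=> e; subst k; rewrite /pmeet /=
  (bool_irrelevance ik (leUl i j)) (bool_irrelevance jk (leUr j i)).
Qed.

Lemma plonka_ibsl : is_involutive_bisemilattice pmeet pjoin pneg pzero pone.
Proof.
split.
- case=> i x; rewrite -/(inj x) (pjoin_inj (lexx i) (lexx i)) ?joinxx //.
  by rewrite tr_id.
- case=> [i x] [j y]; rewrite -/(inj x) -/(inj y).
  rewrite (pjoin_inj (leUl i j) (leUr j i)) //.
  rewrite (pjoin_inj (leUr j i) (leUl i j)) 1?[j `|` i]joinC //.
  by congr inj; exact: joinC.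
- case=> [i x] [j y] [k z]; rewrite -/(inj x) -/(inj y) -/(inj z).
  have il : i <= i `|` j `|` k by rewrite -joinA leUl.
  have jl : j <= i `|` j `|` k by rewrite joinAC leUr.
  have kl : k <= i `|` j `|` k by rewrite leUr.
  have jkl : j `|` k <= i `|` j `|` k by rewrite leUx jl kl.
  rewrite (pjoin_inj (leUl j k) (leUr k j)) //.
  rewrite (pjoin_inj il jkl) ?joinA // (pjoin_inj (leUl i j) (leUr j i)) //.
  rewrite (pjoin_inj (leUl _ _) kl) // !trU /= joinA.
  by do 2?congr (inj (_ `|` _ `|` _)); rewrite -!tr_comp.
- by case=> i x; rewrite /pneg /= complK.
- case=> [i x] [j y]; rewrite /pneg /pmeet /pjoin /= !trN.
  by rewrite complU !complK.
- case=> [i x] [j y]; rewrite /pneg /=.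
  have il : i <= i `|` (i `|` j) by rewrite leUl.
  rewrite -/(inj x) -/(inj y) (pjoin_inj (leUl i j) (leUr j i)) //.
  rewrite (pmeet_inj (leUl i j) (lexx _)) ?joinA ?joinxx //.
  rewrite (pmeet_inj (leUl i j) (leUr j i)) // tr_id trN.
  by rewrite meetUr meetxC join0x.
- case=> i x; rewrite -/(inj x).
  rewrite (pjoin_inj (le0x i) (lexx i)) ?join0x //.
  by rewrite tr0 join0x tr_id.
- by rewrite /pneg /= compl0.
Qed.

Lemma bool_equiv_refl : reflexive (fun a b => `[< bool_equiv a b >]).
Proof. by move=> a; apply/asboolP; exists (tag a), (lexx _), (lexx _). Qed.

Lemma bool_equiv_sym : symmetric (fun a b => `[< bool_equiv a b >]).
Proof.
by move=> a b; apply/asboolP/asboolP => -[k [ak [bk e]]]; exists k, bk, ak.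
Qed.

Lemma bool_equiv_trans : transitive (fun a b => `[< bool_equiv a b >]).
Proof.
move=> b a c /asboolP[k [ak [bk e]]] /asboolP[l [bl [cl e']]].
apply/asboolP; exists (k `|` l), (le_trans ak (leUl _ _)).
exists (le_trans cl (leUr _ _)).
have bkl : tag b <= k `|` l := le_trans bk (leUl _ _).
rewrite (tr_comp D ak (leUl k l)) e (tr_comp D cl (leUr l k)) -e'.
by rewrite -(tr_comp D bk (leUl k l) bkl) -(tr_comp D bl (leUr l k) bkl).
Qed.

Canonical bool_equiv_rel :=
  EquivRel _ bool_equiv_refl bool_equiv_sym bool_equiv_trans.

Definition booleanisation : Type := {eq_quot bool_equiv_rel}.
HB.instance Definition _ := Choice.on booleanisation.
HB.instance Definition _ := EqQuotient.on booleanisation.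

Definition bpi (a : plonka) : booleanisation := \pi_booleanisation a.

Lemma bpiP (a b : plonka) : reflect (bool_equiv a b) (bpi a == bpi b).
Proof. by rewrite /bpi piE; apply: asboolP. Qed.

Lemma bpi_tr (i k : I) (ik : i <= k) (a : fib D i) :
  bpi (inj (tr D ik a)) = bpi (inj a).
Proof. by apply/eqP/bpiP; exists k, (lexx k), ik; rewrite /= tr_id. Qed.

Lemma bpi_meet (i j k : I) (ik : i <= k) (jk : j <= k) (a : fib D i)
    (b : fib D j) :
  bpi (pmeet (inj a) (inj b)) = bpi (inj (tr D ik a `&` tr D jk b)).
Proof.
have ijk : i `|` j <= k by rewrite leUx ik.
rewrite (pmeet_inj (leUl i j) (leUr j i)) // -(bpi_tr ijk) trI.
by rewrite -!(tr_comp _ _ _ ik) -!(tr_comp _ _ _ jk).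
Qed.

Lemma bpi_join (i j k : I) (ik : i <= k) (jk : j <= k) (a : fib D i)
    (b : fib D j) :
  bpi (pjoin (inj a) (inj b)) = bpi (inj (tr D ik a `|` tr D jk b)).
Proof.
have ijk : i `|` j <= k by rewrite leUx ik.
rewrite (pjoin_inj (leUl i j) (leUr j i)) // -(bpi_tr ijk) trU.
by rewrite -!(tr_comp _ _ _ ik) -!(tr_comp _ _ _ jk).
Qed.

Definition bmeet (x y : booleanisation) := bpi (pmeet (repr x) (repr y)).
Definition bjoin (x y : booleanisation) := bpi (pjoin (repr x) (repr y)).
Definition bneg (x : booleanisation) := bpi (pneg (repr x)).
Definition bzero : booleanisation := bpi pzero.
Definition bone : booleanisation := bpi pone.

Lemma repr_bpi a : bool_equiv (repr (bpi a)) a.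
Proof. by apply/bpiP; rewrite /bpi reprK. Qed.

Lemma bmeetE a b : bmeet (bpi a) (bpi b) = bpi (pmeet a b).
Proof.
rewrite /bmeet; move: (repr_bpi a) (repr_bpi b).
case: (repr _) => [i x]; case: (repr _) => [j y]; case: a b => [i' a] [j' b].
move=> [k [/= ik [i'k e]]] [l [/= jl [j'l e']]].
rewrite -/(inj x) -/(inj y) -/(inj a) -/(inj b).
pose m := k `|` l; have km : k <= m := leUl k l.
have lm : l <= m := leUr l k.
rewrite (bpi_meet (le_trans ik km) (le_trans jl lm)).
rewrite (bpi_meet (le_trans i'k km) (le_trans j'l lm)).
rewrite (tr_comp D ik km) (tr_comp D jl lm) e e'.
rewrite -(tr_comp D i'k km (le_trans i'k km)).
by rewrite -(tr_comp D j'l lm (le_trans j'l lm)).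
Qed.

Lemma bjoinE a b : bjoin (bpi a) (bpi b) = bpi (pjoin a b).
Proof.
rewrite /bjoin; move: (repr_bpi a) (repr_bpi b).
case: (repr _) => [i x]; case: (repr _) => [j y]; case: a b => [i' a] [j' b].
move=> [k [/= ik [i'k e]]] [l [/= jl [j'l e']]].
rewrite -/(inj x) -/(inj y) -/(inj a) -/(inj b).
pose m := k `|` l; have km : k <= m := leUl k l.
have lm : l <= m := leUr l k.
rewrite (bpi_join (le_trans ik km) (le_trans jl lm)).
rewrite (bpi_join (le_trans i'k km) (le_trans j'l lm)).
rewrite (tr_comp D ik km) (tr_comp D jl lm) e e'.
rewrite -(tr_comp D i'k km (le_trans i'k km)).
by rewrite -(tr_comp D j'l lm (le_trans j'l lm)).
Qed.

Lemma bnegE a : bneg (bpi a) = bpi (pneg a).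
Proof.
apply/eqP/bpiP; have [k [ik [jk e]]] := repr_bpi a.
by exists k, ik, jk; rewrite /= !trN e.
Qed.

Lemma bmeet_inj k (a b : fib D k) :
  bmeet (bpi (inj a)) (bpi (inj b)) = bpi (inj (a `&` b)).
Proof. by rewrite bmeetE (bpi_meet (lexx k) (lexx k)) !tr_id. Qed.

Lemma bjoin_inj k (a b : fib D k) :
  bjoin (bpi (inj a)) (bpi (inj b)) = bpi (inj (a `|` b)).
Proof. by rewrite bjoinE (bpi_join (lexx k) (lexx k)) !tr_id. Qed.

Lemma bneg_inj k (a : fib D k) : bneg (bpi (inj a)) = bpi (inj (~` a)).
Proof. exact: bnegE. Qed.

Lemma bzeroE k : bzero = bpi (inj (\bot : fib D k)).
Proof. by rewrite -(tr0 (le0x k)) bpi_tr. Qed.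

Lemma boneE k : bone = bpi (inj (\top : fib D k)).
Proof. by rewrite -(tr1 (le0x k)) bpi_tr. Qed.

Lemma booleanisation_common (x y z : booleanisation) :
  exists (k : I) (a b c : fib D k),
    [/\ x = bpi (inj a), y = bpi (inj b) & z = bpi (inj c)].
Proof.
rewrite -[x]reprK -[y]reprK -[z]reprK.
case: (repr x) (repr y) (repr z) => [i a] [j b] [k c].
have il : i <= i `|` j `|` k by rewrite -joinA leUl.
have jl : j <= i `|` j `|` k by rewrite joinAC leUr.
have kl : k <= i `|` j `|` k by rewrite leUr.
exists (i `|` j `|` k), (tr D il a), (tr D jl b), (tr D kl c).
by rewrite !bpi_tr.
Qed.

Let bmeetC : commutative bmeet.
Proof.
move=> x y; have [k [a [b [_ [-> -> _]]]]] := booleanisation_common x y x.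
by rewrite !bmeet_inj meetC.
Qed.
Let bjoinC : commutative bjoin.
Proof.
move=> x y; have [k [a [b [_ [-> -> _]]]]] := booleanisation_common x y x.
by rewrite !bjoin_inj joinC.
Qed.
Let bmeetA : associative bmeet.
Proof.
move=> x y z; have [k [a [b [c [-> -> ->]]]]] := booleanisation_common x y z.
by rewrite !bmeet_inj meetA.
Qed.
Let bjoinA : associative bjoin.
Proof.
move=> x y z; have [k [a [b [c [-> -> ->]]]]] := booleanisation_common x y z.
by rewrite !bjoin_inj joinA.
Qed.
Let bjoinKI y x : bmeet x (bjoin x y) = x.
Proof.
have [k [a [b [_ [-> -> _]]]]] := booleanisation_common x y x.
by rewrite bjoin_inj bmeet_inj joinKI.
Qed.
Let bmeetKU y x : bjoin x (bmeet x y) = x.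
Proof.
have [k [a [b [_ [-> -> _]]]]] := booleanisation_common x y x.
by rewrite bmeet_inj bjoin_inj meetKU.
Qed.
Let bmeetUl : left_distributive bmeet bjoin.
Proof.
move=> x y z; have [k [a [b [c [-> -> ->]]]]] := booleanisation_common x y z.
by rewrite !(bjoin_inj, bmeet_inj) meetUl.
Qed.
Let bmeetxx : idempotent_op bmeet.
Proof.
move=> x; have [k [a [_ [_ [-> _ _]]]]] := booleanisation_common x x x.
by rewrite bmeet_inj meetxx.
Qed.
Let bjoinxN x : bjoin x (bneg x) = bone.
Proof.
have [k [a [_ [_ [-> _ _]]]]] := booleanisation_common x x x.
by rewrite bneg_inj bjoin_inj joinxC -boneE.
Qed.
Let bmeetxN x : bmeet x (bneg x) = bzero.
Proof.
have [k [a [_ [_ [-> _ _]]]]] := booleanisation_common x x x.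
by rewrite bneg_inj bmeet_inj meetxC -bzeroE.
Qed.
Let bmeet0x x : bmeet bzero x == bzero.
Proof.
have [k [a [_ [_ [-> _ _]]]]] := booleanisation_common x x x.
by rewrite (bzeroE k) bmeet_inj meet0x.
Qed.
Let bmeetx1 x : bmeet x bone == x.
Proof.
have [k [a [_ [_ [-> _ _]]]]] := booleanisation_common x x x.
by rewrite (boneE k) bmeet_inj meetx1.
Qed.

HB.instance Definition _ := @Order.isMeetJoinDistrLattice.Build
  (Order.Disp tt tt) booleanisation (fun x y => bmeet x y == x)
  (fun x y => (y != x) && (bmeet x y == x)) bmeet bjoin
  (fun _ _ => erefl) (fun _ _ => erefl) bmeetC bjoinC bmeetA bjoinA
  bjoinKI bmeetKU bmeetUl bmeetxx.
HB.instance Definition _ := @Order.hasBottom.Build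
  (Order.Disp tt tt) booleanisation bzero bmeet0x.
HB.instance Definition _ := @Order.hasTop.Build
  (Order.Disp tt tt) booleanisation bone bmeetx1.
HB.instance Definition _ := @Order.TBDistrLattice_hasComplement.Build
  (Order.Disp tt tt) booleanisation bneg bjoinxN bmeetxN.

Lemma bpiI a b : bpi (pmeet a b) = bpi a `&` bpi b.
Proof. by rewrite -bmeetE. Qed.

Lemma bpiU a b : bpi (pjoin a b) = bpi a `|` bpi b.
Proof. by rewrite -bjoinE. Qed.

Lemma bpiN a : bpi (pneg a) = ~` bpi a.
Proof. by rewrite -bnegE. Qed.

End PlonkaSum.

Local Open Scope ring_scope.

Record state (R : realType) (d d' : Order.disp_t) (I : bJoinSemilatticeType d)
    (D : boolean_system d' I) := State {
  state_fun :> plonka D -> R;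
  state_itv : forall a, 0 <= state_fun a <= 1;
  state_one : state_fun (pone D) = 1;
  state_add : forall a b, is_fib_bot (pmeet a b) ->
    state_fun (pjoin a b) = state_fun a + state_fun b
}.

Definition faithful (R : realType) d d' (I : bJoinSemilatticeType d)
    (D : boolean_system d' I) (s : state R D) : Prop :=
  forall a, ~ is_fib_bot a -> 0 < s a.

Definition symdiff d (A : ctbDistrLatticeType d) (x y : A) : A :=
  ((x `&` ~` y) `|` (~` x `&` y))%O.

Record is_fa_probability (R : realType) d (A : ctbDistrLatticeType d)
    (mu : A -> R) : Prop := IsFAProbability {
  fap_ge0 : forall x, 0 <= mu x;
  fap_top : mu \top%O = 1;
  fap_add : forall x y, (x `&` y = \bot)%O -> mu (x `|` y)%O = mu x + mu y
}.

Record pseudodist (R : realType) (T : Type) := PseudoDist {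
  pdist :> T -> T -> R;
  pdistxx : forall x, pdist x x = 0;
  pdist_sym : forall x y, pdist x y = pdist y x;
  pdist_triangle : forall y x z, pdist x z <= pdist x y + pdist y z
}.

Definition pseudodist_space (R : realType) (T : choiceType)
  (e : pseudodist R T) : Type := T.

Section PseudodistSpace.
Context {R : realType} {T : choiceType} (e : pseudodist R T).
Local Notation M := (pseudodist_space e).

HB.instance Definition _ := Choice.on M.

Definition pd_ball (x : M) (r : R) : set M := [set y | e x y < r]%classic.
Let ent : set_system (M * M) := entourage_ pd_ball.

HB.instance Definition _ := hasNbhs.Build M (nbhs_ ent).

Let ball_center x (r : R) : 0 < r -> pd_ball x r x.
Proof. by rewrite /pd_ball /= pdistxx. Qed.

Let ball_sym x y (r : R) : pd_ball x r y -> pd_ball y r x.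
Proof. by rewrite /pd_ball /= pdist_sym. Qed.

Let ball_triangle x y z r1 r2 :
  pd_ball x r1 y -> pd_ball y r2 z -> pd_ball x (r1 + r2) z.
Proof.
rewrite /pd_ball /= => xy yz.
by rewrite (le_lt_trans (pdist_triangle e y x z)) // ltrD.
Qed.

HB.instance Definition _ := @Nbhs_isPseudoMetric.Build R M
  ent erefl pd_ball ball_center ball_sym ball_triangle erefl.

Lemma pd_ballE (x : M) (r : R) : ball x r = [set y | e x y < r]%classic.
Proof. by []. Qed.

End PseudodistSpace.

Section FAProbability.
Context {R : realType} {d : Order.disp_t} {A : ctbDistrLatticeType d}.
Variables (mu : A -> R) (mu_prob : is_fa_probability mu).

Lemma fap_mono x y : (x <= y)%O -> mu x <= mu y.
Proof.
move=> xy; rewrite -[y in leRHS](joinIB x) (meet_r xy) fap_add.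
- by rewrite lerDl fap_ge0.
- by [].
- by rewrite diffKI.
Qed.

Lemma fap_subadd x y : mu (x `|` y)%O <= mu x + mu y.
Proof.
rewrite -diffKU fap_add //; last by rewrite diffKI.
by rewrite lerD2l fap_mono // diffE leIl.
Qed.

Lemma fap_bot : mu \bot%O = 0.
Proof.
have := fap_add mu_prob (meet0x (\bot : A)%O); rewrite joinxx => h.
by apply: (addrI (mu \bot%O)); rewrite addr0 -h.
Qed.

Lemma symdiff_triangle (x y z : A) :
  (symdiff x z <= symdiff x y `|` symdiff y z)%O.
Proof.
rewrite /symdiff leUx; apply/andP; split.
- rewrite -[leLHS]meetx1 -(joinxC y) meetUr leUx; apply/andP; split.
  + apply: le_trans (leUr _ _); apply: le_trans (leUl _ _).
    by rewrite lexI leIr -meetA meetCA leIl.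
  + apply: le_trans (leUl _ _); apply: le_trans (leUl _ _).
    by rewrite lexI leIr -meetA leIl.
- rewrite -[leLHS]meetx1 -(joinxC y) meetUr leUx; apply/andP; split.
  + apply: le_trans (leUl _ _); apply: le_trans (leUr _ _).
    by rewrite lexI leIr -meetA leIl.
  + apply: le_trans (leUr _ _); apply: le_trans (leUr _ _).
    by rewrite lexI leIr -meetA meetCA leIl.
Qed.

Let dmu x y := mu (symdiff x y).
Let dmuxx x : dmu x x = 0.
Proof. by rewrite /dmu /symdiff meetxC meetCx joinxx fap_bot. Qed.
Let dmu_sym x y : dmu x y = dmu y x.
Proof. by rewrite /dmu /symdiff joinC meetC [X in (_ `|` X)%O]meetC. Qed.
Let dmu_triangle y x z : dmu x z <= dmu x y + dmu y z.
Proof.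
exact: le_trans (fap_mono (symdiff_triangle x y z)) (fap_subadd _ _).
Qed.

Definition fap_dist : pseudodist R A := PseudoDist dmuxx dmu_sym dmu_triangle.

End FAProbability.

Section StateTopology.
Context {R : realType} {d d' : Order.disp_t} {I : bJoinSemilatticeType d}.
Context {D : boolean_system d' I}.
Variable s : state R D.

Lemma state_bot (i : I) : s (inj (\bot%O : fib D i)) = 0.
Proof.
set b := inj _.
have e : pjoin b b = b.
  by rewrite (pjoin_inj (lexx i) (lexx i)) ?joinxx // tr_id.
have e' : is_fib_bot (pmeet b b).
  by exists i; rewrite (pmeet_inj (lexx i) (lexx i)) ?joinxx // !tr_id meetxx.
by have := state_add s e'; rewrite e => h; apply: (addrI (s b)); rewrite addr0.
Qed.

Lemma state_tr (i k : I) (ik : (i <= k)%O) (a : fib D i) :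
  s (inj (tr D ik a)) = s (inj a).
Proof.
have k_ik : k = (i `|` k)%O by apply/esym/join_r.
have e : pjoin (inj a) (inj (\bot%O : fib D k)) = inj (tr D ik a).
  by rewrite (pjoin_inj ik (lexx k)) // tr_id joinx0.
have e' : is_fib_bot (pmeet (inj a) (inj (\bot%O : fib D k))).
  by exists k; rewrite (pmeet_inj ik (lexx k)) // tr_id meetx0.
by rewrite -e state_add // state_bot addr0.
Qed.

Lemma state_equiv a b : bool_equiv a b -> s a = s b.
Proof.
case: a b => [i a] [j b] [k [/= ik [jk e]]].
by rewrite -/(inj a) -/(inj b) -(state_tr ik) e state_tr.
Qed.

(* By PhiE below, the value does not depend on the chosen representative. *)
Definition Phi (x : booleanisation D) : R := s (repr x).

Lemma PhiE (b : plonka D) : Phi (bpi b) = s b.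
Proof. exact/state_equiv/repr_bpi. Qed.

Lemma Phi_probability : is_fa_probability Phi.
Proof.
split.
- by move=> x; have /andP[] := state_itv s (repr x).
- by rewrite -(state_one s) -PhiE.
- move=> x y; have [k [a [b [_ [-> -> _]]]]] := booleanisation_common x y x.
  rewrite -bpiI -bpiU !PhiE => /eqP.
  have -> : \bot%O = bpi (pzero D) by [].
  move=> /bpiP; rewrite (pmeet_inj (lexx k) (lexx k)) ?joinxx // !tr_id.
  case=> l [/= kl [zl e]]; rewrite (bhom0 (tr_hom D zl)) in e.
  rewrite (pjoin_inj (lexx k) (lexx k)) ?joinxx // !tr_id.
  rewrite -!(state_tr kl) -state_add.
    rewrite (pjoin_inj (lexx l) (lexx l)) ?joinxx // !tr_id.
    by rewrite (bhomU (tr_hom D kl)).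
  exists l; rewrite (pmeet_inj (lexx l) (lexx l)) ?joinxx // !tr_id.
  by rewrite -(bhomI (tr_hom D kl)) e.
Qed.

Definition d_inf : pseudodist R (booleanisation D) := fap_dist Phi_probability.

Lemma d_inf_symdiff (x y : booleanisation D) : d_inf x y = Phi (symdiff x y).
Proof. by []. Qed.

Definition booleanisation_space : Type := pseudodist_space d_inf.
HB.instance Definition _ := PseudoMetric.on booleanisation_space.

Let ds (a b : plonka D) : R := s (psymdiff a b).

Lemma d_inf_bpi (a b : plonka D) : d_inf (bpi a) (bpi b) = ds a b.
Proof.
by rewrite d_inf_symdiff /symdiff -!bpiN -!bpiI -bpiU PhiE.
Qed.

Let dsxx a : ds a a = 0.
Proof. by rewrite -d_inf_bpi pdistxx. Qed.
Let ds_sym a b : ds a b = ds b a.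
Proof. by rewrite -!d_inf_bpi pdist_sym. Qed.
Let ds_triangle b a c : ds a c <= ds a b + ds b c.
Proof. by rewrite -!d_inf_bpi pdist_triangle. Qed.

Definition d_state : pseudodist R (plonka D) :=
  PseudoDist dsxx ds_sym ds_triangle.

Lemma d_state_symdiff (a b : plonka D) : d_state a b = s (psymdiff a b).
Proof. by []. Qed.

Definition state_space : Type := pseudodist_space d_state.
HB.instance Definition _ := PseudoMetric.on state_space.

Definition is_section (sigma : booleanisation_space -> state_space) : Prop :=
  continuous sigma /\ forall x, bpi (sigma x) = x.

End StateTopology.

(* Main.v *)
(** [bpi] is distance-preserving, so every set-theoretic right inverse of it is
    an isometry, hence a section. Some section therefore passes through any
    given point [b], and along it [t] must take the value
    [Phi s (bpi b) = s b]. *)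
Require Import Defs.
From mathcomp Require Import all_boot all_order all_algebra.
From mathcomp Require Import boolp classical_sets reals topology normedtype.

Import Order.Theory GRing.Theory Num.Theory.
Import numFieldNormedType.Exports.

Local Open Scope ring_scope.

Lemma bpi_cancel_section (R : realType) (d d' : Order.disp_t)
    (I : bJoinSemilatticeType d) (D : boolean_system d' I) (s : state R D)
    (sigma : booleanisation_space s -> state_space s) :
  (forall x, bpi (sigma x) = x) -> is_section sigma.
Proof.
move=> sigmaK; split=> // x.
have xF : Filter (nbhs x) := nbhs_filter x.
apply/cvg_ballP => e e_gt0.
(* The radius [e] itself serves as modulus of continuity, since [sigma] preserves distances. *)
apply: filterS (nbhsx_ballx x e e_gt0) => y xy.
change (d_state s (sigma x) (sigma y) < e).
(* The distance upstairs equals that of the images under [bpi], which are [x] and [y] again. *)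
by rewrite d_state_symdiff -d_inf_bpi !sigmaK.
Qed.

Lemma section_through (R : realType) (d d' : Order.disp_t)
    (I : bJoinSemilatticeType d) (D : boolean_system d' I) (s : state R D)
    (b : plonka D) :
  exists sigma : booleanisation_space s -> state_space s,
    is_section sigma /\ sigma (bpi b) = b.
Proof.
(* Redirecting one class of the choice [repr] to its member [b] leaves a right inverse of [bpi];
   continuity survives this arbitrary change because every right inverse is continuous. *)
exists (fun x : booleanisation D => if x == bpi b then b else repr x).
split; last by rewrite eqxx.
by apply: bpi_cancel_section => x; case: eqP => [->//|_]; exact: reprK.
Qed.

Theorem theorem6p13 (R : realType) (d d' : Order.disp_t)
    (I : bJoinSemilatticeType d) (D : boolean_system d' I)
    (injD : injective_system D) (s : state R D) (faithful_s : faithful s)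
    (t : state_space s -> R) (t01 : forall b, 0 <= t b <= 1)
    (t_cont : continuous t)
    (t_section : forall sigma : booleanisation_space s -> state_space s,
       is_section sigma -> t \o sigma = Phi s) :
  t = s.
Proof.
apply/funext => b; have [sigma [sigmaS sigmab]] := section_through _ _ _ _ D s b.
by rewrite -PhiE -(t_section sigma sigmaS) /= sigmab.
Qed.
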